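(* Let $\mathsf{C}$ be a strict symmetric monoidal category with symmetry $c$, and let $A$ and $H$ be cocommutative Hopf algebras in $\mathsf{C}$. Let $\pi:A\to H$ be an invertible 1-cocycle with action $\phi_H:A\otimes H\to H$. Then the category ${}_{(\pi,\phi_H)}\mathsf{Mod}$ of left modules over the invertible 1-cocycle $\pi:A\to H$ is symmetric monoidal, with unit object the trivial left module $(K,K,\phi_K=\varepsilon_A,\varphi_K=\varepsilon_H,\phi_K=\varepsilon_A,id_K)$ over $\pi:A\to H$.
   Context: $\mathsf{C}$ is a strict monoidal category with tensor product $\otimes$, unit object $K$ and braiding $c$ (natural isomorphisms $c_{M,N}:M\otimes N\to N\otimes M$ satisfying the hexagon conditions); it is symmetric if $c_{N,M}\circ c_{M,N}=id_{M\otimes N}$ for all $M,N$. For an object $P$ and a morphism $f$, one writes $P\otimes f$ for $id_P\otimes f$ and $f\otimes P$ for $f\otimes id_P$. A Hopf algebra $H$ in $\mathsf{C}$ has unit $\eta_H$, product $\mu_H$, counit $\varepsilon_H$, coproduct $\delta_H$ and antipode $\lambda_H$ (the convolution inverse of $id_H$), where the tensor product of algebras (coalgebras) is an algebra (coalgebra) via the braiding $c$. $H$ is cocommutative if $c_{H,H}\circ\delta_H=\delta_H$. Left modules over an algebra and their morphisms are the usual ones (unital, associative actions; morphisms commute with the actions). Module algebra: for a Hopf algebra $D$, an algebra $B$ is a left $D$-module algebra with action $\phi_B:D\otimes B\to B$ if $(B,\phi_B)$ is a left $D$-module, $\phi_B\circ(D\otimes\eta_B)=\varepsilon_D\otimes\eta_B$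 and $\phi_B\circ(D\otimes\mu_B)=\mu_B\circ(\phi_B\otimes\phi_B)\circ(D\otimes c_{D,B}\otimes B)\circ(\delta_D\otimes B\otimes B)$. Invertible 1-cocycle: let $A,H$ be Hopf algebras in $\mathsf{C}$ such that $H$ is a left $A$-module algebra with action $\phi_H$. A coalgebra morphism $\pi:A\to H$ is an invertible 1-cocycle (with action $\phi_H$) if it is an isomorphism and $\pi\circ\mu_A=\mu_H\circ(\pi\otimes\phi_H)\circ(\delta_A\otimes\pi)$. A left module over the invertible 1-cocycle $\pi:A\to H$ is a 6-tuple $(M,N,\phi_M,\varphi_M,\phi_N,\gamma)$ where: (i) $(M,\phi_M)$ is a left $A$-module, $(M,\varphi_M)$ is a left $H$-module and $\phi_M\circ(A\otimes\varphi_M)=\varphi_M\circ(\phi_H\otimes\phi_M)\circ(A\otimes c_{A,H}\otimes M)\circ(\delta_A\otimes H\otimes M)$; (ii) $(N,\phi_N)$ is a left $A$-module; (iii) $\gamma:N\to M$ is an isomorphism in $\mathsf{C}$ with $\gamma\circ\phi_N=\varphi_M\circ(\pi\otimes\phi_M)\circ(\delta_A\otimes\gamma)$. A morphism $(M,N,\phi_M,\varphi_M,\phi_N,\gamma)\to(M',N',\phi_{M'},\varphi_{M'},\phi_{N'},\gamma')$ is a pair $(h,l)$ with $h:M\to M'$ a morphism of left $A$-modules and of left $H$-modules, $l:N\to N'$ a morphism of left $A$-modules and $h\circ\gamma=\gamma'\circ l$. These form the category ${}_{(\pi,\phi_H)}\mathsf{Mod}$, with componentwise composition. *)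

(* Defs.v *)
From Stdlib Require Import ProofIrrelevance.

Set Implicit Arguments.
Unset Strict Implicit.
Unset Printing Implicit Defensive.

Record Category := {
  Ob :> Type;
  Hom : Ob -> Ob -> Type;
  idm : forall a, Hom a a;
  comp : forall a b c, Hom b c -> Hom a b -> Hom a c;
  comp_idl : forall a b (f : Hom a b), comp (idm b) f = f;
  comp_idr : forall a b (f : Hom a b), comp f (idm a) = f;
  comp_assoc : forall a b c d (h : Hom c d) (g : Hom b c) (f : Hom a b),
    comp h (comp g f) = comp (comp h g) f }.


Arguments Hom {_} _ _.
Arguments idm {_} _.
Arguments comp {_ _ _ _} _ _.

Notation "g ∘ f" := (comp g f) (at level 40, left associativity).

Record Iso {C : Category} (a b : C) := {
  fwd :> Hom a b;
  bwd : Hom b a;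
  bwd_fwd : bwd ∘ fwd = idm a;
  fwd_bwd : fwd ∘ bwd = idm b }.

Arguments fwd {_ _ _} _.
Arguments bwd {_ _ _} _.

Definition is_iso {C : Category} {a b : C} (f : Hom a b) : Prop :=
  exists g : Hom b a, g ∘ f = idm a /\ f ∘ g = idm b.

Definition hom_of_eq {C : Category} {a b : C} (e : a = b) : Hom a b :=
  match e in _ = b' return Hom a b' with eq_refl => idm a end.

Reserved Notation "a ⊗ b" (at level 38, left associativity).
Reserved Notation "f ⊗₁ g" (at level 38, left associativity).

Class Monoidal (C : Category) := {
  tens : C -> C -> C where "a ⊗ b" := (tens a b);
  tensM : forall a a' b b', Hom a a' -> Hom b b' -> Hom (a ⊗ b) (a' ⊗ b')
    where "f ⊗₁ g" := (tensM f g);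
  munit : C;
  tensM_id : forall a b, idm a ⊗₁ idm b = idm (a ⊗ b);
  tensM_comp : forall a a' a'' b b' b''
      (f' : Hom a' a'') (f : Hom a a') (g' : Hom b' b'') (g : Hom b b'),
    (f' ∘ f) ⊗₁ (g' ∘ g) = (f' ⊗₁ g') ∘ (f ⊗₁ g);
  assoc : forall a b c, Iso ((a ⊗ b) ⊗ c) (a ⊗ (b ⊗ c));
  lunit : forall a, Iso (munit ⊗ a) a;
  runit : forall a, Iso (a ⊗ munit) a;
  assoc_nat : forall a a' b b' c c' (f : Hom a a') (g : Hom b b') (h : Hom c c'),
    assoc a' b' c' ∘ ((f ⊗₁ g) ⊗₁ h) = (f ⊗₁ (g ⊗₁ h)) ∘ assoc a b c;
  lunit_nat : forall a a' (f : Hom a a'),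
    lunit a' ∘ (idm munit ⊗₁ f) = f ∘ lunit a;
  runit_nat : forall a a' (f : Hom a a'),
    runit a' ∘ (f ⊗₁ idm munit) = f ∘ runit a;
  triangle : forall a b,
    (idm a ⊗₁ lunit b) ∘ assoc a munit b = runit a ⊗₁ idm b;
  pentagon : forall a b c d,
    assoc a b (c ⊗ d) ∘ assoc (a ⊗ b) c d
    = (idm a ⊗₁ assoc b c d) ∘ assoc a (b ⊗ c) d ∘ (assoc a b c ⊗₁ idm d) }.

Arguments tens {C _} _ _.
Arguments tensM {C _ _ _ _ _} _ _.
Arguments munit {C _}.
Arguments assoc {C _} _ _ _.
Arguments lunit {C _} _.
Arguments runit {C _} _.

Notation "a ⊗ b" := (tens a b).
Notation "f ⊗₁ g" := (tensM f g).

(* Strictness: the tensor is associative and unital on objects, and the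
   constraints are the identities, read along these equalities of objects.
   Formulas below still display the constraints, for typing reasons; over a
   strict category they can all be erased. *)
Record is_strict {C : Category} (T : Monoidal C) : Prop := {
  strict_assoc : forall a b c : C,
    exists e : (a ⊗ b) ⊗ c = a ⊗ (b ⊗ c), fwd (assoc a b c) = hom_of_eq e;
  strict_lunit : forall a : C,
    exists e : munit ⊗ a = a, fwd (lunit a) = hom_of_eq e;
  strict_runit : forall a : C,
    exists e : a ⊗ munit = a, fwd (runit a) = hom_of_eq e }.

Class Braiding {C : Category} (T : Monoidal C) := {
  braid : forall a b : C, Iso (a ⊗ b) (b ⊗ a);
  braid_nat : forall (a a' b b' : C) (f : Hom a a') (g : Hom b b'),
    braid a' b' ∘ (f ⊗₁ g) = (g ⊗₁ f) ∘ braid a b;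
  hexagon1 : forall a b c : C,
    assoc b c a ∘ braid a (b ⊗ c) ∘ assoc a b c
    = (idm b ⊗₁ braid a c) ∘ assoc b a c ∘ (braid a b ⊗₁ idm c);
  hexagon2 : forall a b c : C,
    bwd (assoc c a b) ∘ braid (a ⊗ b) c ∘ bwd (assoc a b c)
    = (braid a c ⊗₁ idm b) ∘ bwd (assoc a c b) ∘ (idm a ⊗₁ braid b c) }.

Arguments braid {C T _} _ _.

Definition is_symmetric {C : Category} {T : Monoidal C} (B : Braiding T) : Prop :=
  forall a b : C, braid b a ∘ braid a b = idm (a ⊗ b).

(* [a ⊗ c_{b,c} ⊗ d], with the bracketing made explicit. *)
Definition exch {C : Category} {T : Monoidal C} {B : Braiding T} (a b c d : C) :
    Hom ((a ⊗ b) ⊗ (c ⊗ d)) ((a ⊗ c) ⊗ (b ⊗ d)) :=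
  bwd (assoc a c (b ⊗ d))
  ∘ (idm a ⊗₁ (assoc c b d ∘ (braid b c ⊗₁ idm d) ∘ bwd (assoc b c d)))
  ∘ assoc a b (c ⊗ d).

Record is_algebra {C : Category} {T : Monoidal C} (A : C)
    (eta : Hom munit A) (mu : Hom (A ⊗ A) A) : Prop := {
  alg_unitl : mu ∘ (eta ⊗₁ idm A) = lunit A;
  alg_unitr : mu ∘ (idm A ⊗₁ eta) = runit A;
  alg_assoc : mu ∘ (mu ⊗₁ idm A) = mu ∘ (idm A ⊗₁ mu) ∘ assoc A A A }.

Record is_coalgebra {C : Category} {T : Monoidal C} (A : C)
    (eps : Hom A munit) (delta : Hom A (A ⊗ A)) : Prop := {
  coalg_counitl : lunit A ∘ (eps ⊗₁ idm A) ∘ delta = idm A;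
  coalg_counitr : runit A ∘ (idm A ⊗₁ eps) ∘ delta = idm A;
  coalg_coassoc :
    assoc A A A ∘ (delta ⊗₁ idm A) ∘ delta = (idm A ⊗₁ delta) ∘ delta }.

Record is_algebra_mor {C : Category} {T : Monoidal C} {A B : C}
    (etaA : Hom munit A) (muA : Hom (A ⊗ A) A)
    (etaB : Hom munit B) (muB : Hom (B ⊗ B) B) (f : Hom A B) : Prop := {
  algmor_unit : f ∘ etaA = etaB;
  algmor_mul : f ∘ muA = muB ∘ (f ⊗₁ f) }.

Record is_coalgebra_mor {C : Category} {T : Monoidal C} {A B : C}
    (epsA : Hom A munit) (deltaA : Hom A (A ⊗ A))
    (epsB : Hom B munit) (deltaB : Hom B (B ⊗ B)) (f : Hom A B) : Prop := {
  coalgmor_counit : epsB ∘ f = epsA;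
  coalgmor_comul : deltaB ∘ f = (f ⊗₁ f) ∘ deltaA }.

Definition tens_eta {C : Category} {T : Monoidal C} {A B : C}
    (etaA : Hom munit A) (etaB : Hom munit B) : Hom munit (A ⊗ B) :=
  (etaA ⊗₁ etaB) ∘ bwd (lunit munit).

Definition tens_mu {C : Category} {T : Monoidal C} {Br : Braiding T} {A B : C}
    (muA : Hom (A ⊗ A) A) (muB : Hom (B ⊗ B) B) :
    Hom ((A ⊗ B) ⊗ (A ⊗ B)) (A ⊗ B) :=
  (muA ⊗₁ muB) ∘ exch A B A B.

Definition convolution {C : Category} {T : Monoidal C} {A B : C}
    (delta : Hom A (A ⊗ A)) (mu : Hom (B ⊗ B) B) (f g : Hom A B) : Hom A B :=
  mu ∘ (f ⊗₁ g) ∘ delta.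

Record HopfAlgebra {C : Category} {T : Monoidal C} (B : Braiding T) := {
  hopf_ob :> C;
  eta : Hom munit hopf_ob;
  mu : Hom (hopf_ob ⊗ hopf_ob) hopf_ob;
  eps : Hom hopf_ob munit;
  delta : Hom hopf_ob (hopf_ob ⊗ hopf_ob);
  antipode : Hom hopf_ob hopf_ob;
  hopf_algebra : is_algebra eta mu;
  hopf_coalgebra : is_coalgebra eps delta;
  hopf_eps_mor : is_algebra_mor eta mu (idm munit) (lunit munit) eps;
  hopf_delta_mor : is_algebra_mor eta mu (tens_eta eta eta) (tens_mu mu mu) delta;
  hopf_antipodel : convolution delta mu antipode (idm hopf_ob) = eta ∘ eps;
  hopf_antipoder : convolution delta mu (idm hopf_ob) antipode = eta ∘ eps }.

Arguments eta {C T B} _.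
Arguments mu {C T B} _.
Arguments eps {C T B} _.
Arguments delta {C T B} _.
Arguments antipode {C T B} _.

Definition is_cocommutative {C : Category} {T : Monoidal C} {B : Braiding T}
    (H : HopfAlgebra B) : Prop :=
  braid H H ∘ delta H = delta H.

Record is_module {C : Category} {T : Monoidal C} {B : Braiding T}
    (A : HopfAlgebra B) {M : C} (phi : Hom (A ⊗ M) M) : Prop := {
  mod_unit : phi ∘ (eta A ⊗₁ idm M) = lunit M;
  mod_assoc : phi ∘ (mu A ⊗₁ idm M) = phi ∘ (idm A ⊗₁ phi) ∘ assoc A A M }.

Definition is_module_mor {C : Category} {T : Monoidal C} {B : Braiding T}
    (A : HopfAlgebra B) {M M' : C} (phi : Hom (A ⊗ M) M) (phi' : Hom (A ⊗ M') M')
    (f : Hom M M') : Prop :=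
  f ∘ phi = phi' ∘ (idm A ⊗₁ f).

Definition tens_action {C : Category} {T : Monoidal C} {B : Braiding T}
    (A : HopfAlgebra B) {M P : C} (phiM : Hom (A ⊗ M) M) (phiP : Hom (A ⊗ P) P) :
    Hom (A ⊗ (M ⊗ P)) (M ⊗ P) :=
  (phiM ⊗₁ phiP) ∘ exch A A M P ∘ (delta A ⊗₁ idm (M ⊗ P)).

(* [ε_A : A → K], seen as a map on [A ⊗ K]. *)
Definition triv_action {C : Category} {T : Monoidal C} {B : Braiding T}
    (A : HopfAlgebra B) : Hom (A ⊗ munit) munit :=
  eps A ∘ runit A.

Record is_module_algebra {C : Category} {T : Monoidal C} {B : Braiding T}
    (D : HopfAlgebra B) {E : C} (etaE : Hom munit E) (muE : Hom (E ⊗ E) E)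
    (phi : Hom (D ⊗ E) E) : Prop := {
  modalg_module : is_module phi;
  modalg_unit : phi ∘ (idm D ⊗₁ etaE) = lunit E ∘ (eps D ⊗₁ etaE);
  modalg_mul : phi ∘ (idm D ⊗₁ muE)
    = muE ∘ (phi ⊗₁ phi) ∘ exch D D E E ∘ (delta D ⊗₁ idm (E ⊗ E)) }.

Record is_invertible_cocycle {C : Category} {T : Monoidal C} {B : Braiding T}
    (A H : HopfAlgebra B) (phiH : Hom (A ⊗ H) H) (pi : Hom A H) : Prop := {
  cocycle_coalg : is_coalgebra_mor (eps A) (delta A) (eps H) (delta H) pi;
  cocycle_iso : is_iso pi;
  cocycle_mul : pi ∘ mu A = mu H ∘ (pi ⊗₁ phiH) ∘ assoc A A H ∘ (delta A ⊗₁ pi) }.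

Record cocycle_module_data {C : Category} {T : Monoidal C} {B : Braiding T}
    (A H : HopfAlgebra B) := CocycleModuleData {
  cm_M : C;
  cm_N : C;
  cm_phiM : Hom (A ⊗ cm_M) cm_M;
  cm_varphiM : Hom (H ⊗ cm_M) cm_M;
  cm_phiN : Hom (A ⊗ cm_N) cm_N;
  cm_gamma : Hom cm_N cm_M }.

Arguments CocycleModuleData {C T B A H cm_M cm_N} _ _ _ _.

Record is_cocycle_module {C : Category} {T : Monoidal C} {B : Braiding T}
    (A H : HopfAlgebra B) (phiH : Hom (A ⊗ H) H) (pi : Hom A H)
    (X : cocycle_module_data A H) : Prop := {
  cm_phiM_module : is_module (cm_phiM X);
  cm_varphiM_module : is_module (cm_varphiM X);
  cm_compat : cm_phiM X ∘ (idm A ⊗₁ cm_varphiM X)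
    = cm_varphiM X ∘ (phiH ⊗₁ cm_phiM X) ∘ exch A A H (cm_M X)
      ∘ (delta A ⊗₁ idm (H ⊗ cm_M X));
  cm_phiN_module : is_module (cm_phiN X);
  cm_gamma_iso : is_iso (cm_gamma X);
  cm_gamma_eq : cm_gamma X ∘ cm_phiN X
    = cm_varphiM X ∘ (pi ⊗₁ cm_phiM X) ∘ assoc A A (cm_M X)
      ∘ (delta A ⊗₁ cm_gamma X) }.

Record cocycle_module {C : Category} {T : Monoidal C} {B : Braiding T}
    (A H : HopfAlgebra B) (phiH : Hom (A ⊗ H) H) (pi : Hom A H) := {
  cm_data :> cocycle_module_data A H;
  cm_prop : is_cocycle_module phiH pi cm_data }.

Arguments cm_data {C T B A H phiH pi} _.

Record cocycle_module_mor {C : Category} {T : Monoidal C} {B : Braiding T}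
    {A H : HopfAlgebra B} (X Y : cocycle_module_data A H) := CocycleModuleMor {
  cmm_h : Hom (cm_M X) (cm_M Y);
  cmm_l : Hom (cm_N X) (cm_N Y);
  cmm_h_phi : is_module_mor (cm_phiM X) (cm_phiM Y) cmm_h;
  cmm_h_varphi : is_module_mor (cm_varphiM X) (cm_varphiM Y) cmm_h;
  cmm_l_phi : is_module_mor (cm_phiN X) (cm_phiN Y) cmm_l;
  cmm_gamma : cmm_h ∘ cm_gamma X = cm_gamma Y ∘ cmm_l }.

Arguments CocycleModuleMor {C T B A H X Y} _ _ _ _ _ _.

Lemma cocycle_module_mor_eq {C : Category} {T : Monoidal C} {B : Braiding T}
    {A H : HopfAlgebra B} {X Y : cocycle_module_data A H}
    (f g : cocycle_module_mor X Y) :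
  cmm_h f = cmm_h g -> cmm_l f = cmm_l g -> f = g.
Proof.
destruct f, g; simpl; intros -> ->; f_equal; apply proof_irrelevance.
Qed.

Lemma is_module_mor_id {C : Category} {T : Monoidal C} {B : Braiding T}
    {A : HopfAlgebra B} {M : C} (phi : Hom (A ⊗ M) M) :
  is_module_mor phi phi (idm M).
Proof.
unfold is_module_mor; now rewrite tensM_id, comp_idl, comp_idr.
Qed.

Lemma is_module_mor_comp {C : Category} {T : Monoidal C} {B : Braiding T}
    {A : HopfAlgebra B} {M M' M'' : C} (phi : Hom (A ⊗ M) M)
    (phi' : Hom (A ⊗ M') M') (phi'' : Hom (A ⊗ M'') M'')
    (g : Hom M' M'') (f : Hom M M') :
  is_module_mor phi' phi'' g -> is_module_mor phi phi' f ->
  is_module_mor phi phi'' (g ∘ f).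
Proof.
unfold is_module_mor; intros Hg Hf.
rewrite <- comp_assoc, Hf, comp_assoc, Hg, <- comp_assoc, <- tensM_comp.
now rewrite comp_idl.
Qed.

Definition cmm_id {C : Category} {T : Monoidal C} {B : Braiding T}
    {A H : HopfAlgebra B} (X : cocycle_module_data A H) : cocycle_module_mor X X.
Proof.
refine (CocycleModuleMor (idm _) (idm _) (is_module_mor_id _) (is_module_mor_id _)
  (is_module_mor_id _) _).
abstract (now rewrite comp_idl, comp_idr).
Defined.

Definition cmm_comp {C : Category} {T : Monoidal C} {B : Braiding T}
    {A H : HopfAlgebra B} {X Y Z : cocycle_module_data A H}
    (g : cocycle_module_mor Y Z) (f : cocycle_module_mor X Y) :
    cocycle_module_mor X Z.
Proof.
refine (CocycleModuleMor (cmm_h g ∘ cmm_h f) (cmm_l g ∘ cmm_l f)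
  (is_module_mor_comp (cmm_h_phi g) (cmm_h_phi f))
  (is_module_mor_comp (cmm_h_varphi g) (cmm_h_varphi f))
  (is_module_mor_comp (cmm_l_phi g) (cmm_l_phi f)) _).
abstract (now rewrite <- comp_assoc, cmm_gamma, comp_assoc, cmm_gamma, comp_assoc).
Defined.

Definition CocycleMod {C : Category} {T : Monoidal C} {B : Braiding T}
    {A H : HopfAlgebra B} (phiH : Hom (A ⊗ H) H) (pi : Hom A H) : Category.
Proof.
refine {| Ob := cocycle_module phiH pi;
          Hom := fun X Y => cocycle_module_mor X Y;
          idm := fun X => cmm_id X;
          comp := fun X Y Z g f => cmm_comp g f |}.
- abstract (intros; apply cocycle_module_mor_eq; apply comp_idl).
- abstract (intros; apply cocycle_module_mor_eq; apply comp_idr).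
- abstract (intros; apply cocycle_module_mor_eq; apply comp_assoc).
Defined.

Definition triv_cocycle_module {C : Category} {T : Monoidal C} {B : Braiding T}
    (A H : HopfAlgebra B) : cocycle_module_data A H :=
  CocycleModuleData (triv_action A) (triv_action H) (triv_action A) (idm munit).

Definition tens_cocycle_module {C : Category} {T : Monoidal C} {B : Braiding T}
    {A H : HopfAlgebra B} (X Y : cocycle_module_data A H) :
    cocycle_module_data A H :=
  CocycleModuleData
    (tens_action (cm_phiM X) (cm_phiM Y))
    (tens_action (cm_varphiM X) (cm_varphiM Y))
    (tens_action (cm_phiN X) (cm_phiN Y))
    (cm_gamma X ⊗₁ cm_gamma Y).

(* Main.v *)
Require Import Defs.
From Corelib Require Import ssreflect.

(** Write [a.m] for the action of [A] and [h*m] for that of [H].  The tensor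
    product of two modules over the cocycle carries the diagonal actions of
    [A] and [H] on both components, and [γ ⊗ γ'].  Everything is inherited
    from [C] once two facts are known.

    First, modules over a cocommutative Hopf algebra [D], with diagonal
    action, form a symmetric monoidal category whose constraints are those of
    [C]: [assoc_module_mor] is coassociativity, [lunit_module_mor] is the
    counit law, [braid_module_mor] is cocommutativity.  Hence
    [exch : (M ⊗ N) ⊗ (P ⊗ Q) → (M ⊗ P) ⊗ (N ⊗ Q)] is also a morphism of
    [D]-modules.

    Second, [φ_H] makes [H] a coalgebra in [A]-modules: [δ_H] and [ε_H] are
    [A]-linear ([delta_module_mor], [counit_module_mor]).  This is where the
    cocycle is used.  The cocycle identity says that [π] is [A]-linear from
    [A] to [H] with the action [a ⋅ h = π(a₁) (a₂.h)].  More generally, for an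
    object [M] with both actions, put [a ⋅ m = π(a₁) * (a₂.m)]
    ([cocycle_action]); cocommutativity of [A] makes this construction
    compatible with diagonal actions ([cocycle_action_tens]).  As [π], [μ_A]
    and [μ_H] are compatible with the coproducts, the two sides of the
    linearity of [δ_H] agree after being put under [π(a₁) * -]; this operation is
    injective since [π] has the convolution inverse [λ_H ∘ π]
    ([cocycle_action_cancel]).

    The axioms of the tensor product then come without computation.  The
    condition relating the two actions on [M] says that
    [H ⊗ M → M] is [A]-linear.  For [M ⊗ P] this map is the composite of
    [δ_H ⊗ id], [exch] and the two actions, all of them [A]-linear.  The
    condition on [γ] says that [γ] is [A]-linear from [N] to [M] with the
    action [a ⋅ m], so it passes to tensor products by
    [cocycle_action_tens].

    The coherence diagrams for [exch] are proved in a strict model: each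
    object [a] is represented by the functor [x ↦ a ⊗ x], where associators
    and unitors become identities. *)

Set Implicit Arguments.
Unset Strict Implicit.
Unset Printing Implicit Defensive.

(** * Coherence in a symmetric monoidal category *)

Section Monoidal.
Context {C : Category} {T : Monoidal C}.

Lemma tensM_compl (a b c d : C) (g : Hom b c) (f : Hom a b) :
  (g ∘ f) ⊗₁ idm d = (g ⊗₁ idm d) ∘ (f ⊗₁ idm d).
Proof. by rewrite -tensM_comp comp_idl. Qed.

Lemma tensM_compr (a b c d : C) (g : Hom b c) (f : Hom a b) :
  idm d ⊗₁ (g ∘ f) = (idm d ⊗₁ g) ∘ (idm d ⊗₁ f).
Proof. by rewrite -tensM_comp comp_idl. Qed.

(** Composites are kept nested to the right; this form of an equation
    rewrites two adjacent factors in the middle of such a chain.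
    [comp_eqr3] and [tensM_comp_eqr] serve the same purpose. *)
Lemma comp_eqr (a b c d : C) (g : Hom b c) (f : Hom a b) (k : Hom a c) :
  g ∘ f = k -> forall r : Hom d a, g ∘ (f ∘ r) = k ∘ r.
Proof. by move=> e r; rewrite comp_assoc e. Qed.

Lemma comp_eqr3 (a b c d e : C) (h : Hom c d) (g : Hom b c) (f : Hom a b) (k : Hom a d) :
  h ∘ g ∘ f = k -> forall r : Hom e a, h ∘ (g ∘ (f ∘ r)) = k ∘ r.
Proof. by move=> e' r; rewrite !comp_assoc e'. Qed.

Lemma tensM_comp_eqr (a a' a'' b b' b'' d : C) (f' : Hom a' a'') (f : Hom a a')
    (g' : Hom b' b'') (g : Hom b b') (r : Hom d (a ⊗ b)) :
  (f' ⊗₁ g') ∘ ((f ⊗₁ g) ∘ r) = ((f' ∘ f) ⊗₁ (g' ∘ g)) ∘ r.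
Proof. by rewrite comp_assoc tensM_comp. Qed.

Lemma tensM_lr (a b c d : C) (f : Hom a b) (g : Hom c d) :
  f ⊗₁ g = (f ⊗₁ idm d) ∘ (idm a ⊗₁ g).
Proof. by rewrite -tensM_comp comp_idl comp_idr. Qed.

Lemma tensM_rl (a b c d : C) (f : Hom a b) (g : Hom c d) :
  f ⊗₁ g = (idm b ⊗₁ g) ∘ (f ⊗₁ idm c).
Proof. by rewrite -tensM_comp comp_idl comp_idr. Qed.

Lemma iso_cancelr (a b c : C) (i : Iso a b) (f g : Hom b c) :
  f ∘ i = g ∘ i -> f = g.
Proof.
by move=> e; rewrite -(comp_idr f) -(comp_idr g) -(fwd_bwd i) !comp_assoc e.
Qed.

Lemma iso_cancell (a b c : C) (i : Iso b c) (f g : Hom a b) :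
  i ∘ f = i ∘ g -> f = g.
Proof.
by move=> e; rewrite -(comp_idl f) -(comp_idl g) -(bwd_fwd i) -!comp_assoc e.
Qed.

Definition iso_id (a : C) : Iso a a.
Proof. by refine {| fwd := idm a; bwd := idm a |}; rewrite comp_idl. Defined.

Definition iso_comp (a b c : C) (j : Iso b c) (i : Iso a b) : Iso a c.
Proof.
refine {| fwd := j ∘ i; bwd := bwd i ∘ bwd j |}.
- by rewrite -comp_assoc (comp_assoc (bwd j)) bwd_fwd comp_idl bwd_fwd.
- by rewrite -comp_assoc (comp_assoc i) fwd_bwd comp_idl fwd_bwd.
Defined.

Definition iso_tens (a a' b b' : C) (i : Iso a a') (j : Iso b b') :
  Iso (a ⊗ b) (a' ⊗ b').
Proof.
refine {| fwd := i ⊗₁ j; bwd := bwd i ⊗₁ bwd j |}.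
- by rewrite -tensM_comp !bwd_fwd tensM_id.
- by rewrite -tensM_comp !fwd_bwd tensM_id.
Defined.

Lemma tens_unitl_faithful (a b : C) (f g : Hom a b) :
  idm munit ⊗₁ f = idm munit ⊗₁ g -> f = g.
Proof.
move=> e; apply: (@iso_cancelr _ _ _ (lunit a)).
by rewrite -!lunit_nat e.
Qed.

Lemma tens_unitr_faithful (a b : C) (f g : Hom a b) :
  f ⊗₁ idm munit = g ⊗₁ idm munit -> f = g.
Proof.
move=> e; apply: (@iso_cancelr _ _ _ (runit a)).
by rewrite -!runit_nat e.
Qed.

(** Kelly's redundant unit axiom: after tensoring with the unit object on the
    left, which is faithful, it follows from the pentagon and the triangle. *)
Lemma lunit_tens (a b : C) : lunit (a ⊗ b) ∘ assoc munit a b = lunit a ⊗₁ idm b.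
Proof.
apply: tens_unitl_faithful.
apply: (@iso_cancelr _ _ _ (assoc munit (munit ⊗ a) b)).
apply: (@iso_cancelr _ _ _ (iso_tens (assoc munit munit a) (iso_id b))) => /=.
rewrite tensM_compr -assoc_nat -!comp_assoc.
rewrite -tensM_compl triangle (comp_assoc (idm _ ⊗₁ assoc _ _ _)) -pentagon comp_assoc triangle.
by rewrite -tensM_id -assoc_nat.
Qed.

(** Formal tensor products.  They are needed because the model below depends on
    how an object is written as a tensor product. *)
Inductive tree := leaf (c : C) | tunit | node (a b : tree).

Fixpoint obj (a : tree) : C :=
  match a with leaf c => c | tunit => munit | node a b => obj a ⊗ obj b end.

(** [act a] is isomorphic to [obj a ⊗ -] through [flat], but bracketed to the
    right: [act] of a rebracketed tree is the same object by computation. *)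
Fixpoint act (a : tree) (x : C) : C :=
  match a with
  | leaf c => c ⊗ x | tunit => x | node a b => act a (act b x) end.

Fixpoint actM (a : tree) {x y : C} (f : Hom x y) : Hom (act a x) (act a y) :=
  match a with
  | leaf c => idm c ⊗₁ f | tunit => f | node a b => actM a (actM b f) end.

Fixpoint flat (a : tree) (x : C) : Iso (obj a ⊗ x) (act a x) :=
  match a with
  | leaf c => iso_id (c ⊗ x)
  | tunit => lunit x
  | node a b =>
      iso_comp (flat a (act b x))
        (iso_comp (iso_tens (iso_id (obj a)) (flat b x)) (assoc (obj a) (obj b) x))
  end.

(** The morphism [f ⊗ id] transported along [flat].  Only the defining square
    is exposed: were the formula for [rep] transparent, the associativity of
    composition would also rewrite inside it. *)
Lemma rep_exists (a b : tree) (f : Hom (obj a) (obj b)) (x : C) :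
  {r : Hom (act a x) (act b x) | r ∘ flat a x = flat b x ∘ (f ⊗₁ idm x)}.
Proof.
exists (flat b x ∘ (f ⊗₁ idm x) ∘ bwd (flat a x)).
by rewrite -comp_assoc bwd_fwd comp_idr.
Qed.

Definition rep (a b : tree) (f : Hom (obj a) (obj b)) (x : C) :
    Hom (act a x) (act b x) := proj1_sig (rep_exists f x).

Lemma actM_id (a : tree) (x : C) : actM a (idm x) = idm (act a x).
Proof.
elim: a x => [c|//|a IHa b IHb] x /=; first exact: tensM_id.
by rewrite IHb IHa.
Qed.

Lemma actM_comp (a : tree) (x y z : C) (g : Hom y z) (f : Hom x y) :
  actM a (g ∘ f) = actM a g ∘ actM a f.
Proof.
elim: a x y z g f => [c|//|a IHa b IHb] x y z g f /=; first exact: tensM_compr.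
by rewrite IHb IHa.
Qed.

Lemma flat_nat (a : tree) (x y : C) (f : Hom x y) :
  flat a y ∘ (idm (obj a) ⊗₁ f) = actM a f ∘ flat a x.
Proof.
elim: a x y f => [c|//|a IHa b IHb] x y f /=.
- by rewrite comp_idl comp_idr.
- exact: lunit_nat.
- rewrite -tensM_id -!comp_assoc assoc_nat.
  rewrite [in X in _ ∘ X]comp_assoc -tensM_compr IHb tensM_compr.
  by rewrite !comp_assoc IHa.
Qed.

Lemma rep_flat (a b : tree) (f : Hom (obj a) (obj b)) (x : C) :
  rep f x ∘ flat a x = flat b x ∘ (f ⊗₁ idm x).
Proof. exact: (proj2_sig (rep_exists f x)). Qed.

Lemma rep_unique (a b : tree) (f : Hom (obj a) (obj b)) (x : C)
    (r : Hom (act a x) (act b x)) :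
  flat b x ∘ (f ⊗₁ idm x) = r ∘ flat a x -> rep f x = r.
Proof. by move=> e; apply: (@iso_cancelr _ _ _ (flat a x)); rewrite rep_flat. Qed.

(** Evaluation at the unit object already determines [f]. *)
Lemma rep_faithful (a b : tree) (f g : Hom (obj a) (obj b)) :
  (forall x, rep f x = rep g x) -> f = g.
Proof.
move=> e; apply: tens_unitr_faithful.
by apply: (@iso_cancell _ _ _ (flat b munit)); rewrite -!rep_flat e.
Qed.

Lemma rep_id (a : tree) (x : C) : rep (idm (obj a)) x = idm (act a x).
Proof. by apply: rep_unique; rewrite tensM_id comp_idl comp_idr. Qed.

Lemma rep_comp (a b c : tree) (g : Hom (obj b) (obj c)) (f : Hom (obj a) (obj b)) x :
  rep (a := a) (b := c) (g ∘ f) x = rep g x ∘ rep f x.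
Proof.
apply: rep_unique; rewrite tensM_compl comp_assoc -rep_flat.
by rewrite -!comp_assoc rep_flat.
Qed.

Lemma rep_nat (a b : tree) (f : Hom (obj a) (obj b)) (x y : C) (h : Hom x y) :
  actM b h ∘ rep f x = rep f y ∘ actM a h.
Proof.
apply: (@iso_cancelr _ _ _ (flat a x)).
rewrite -!comp_assoc rep_flat -flat_nat !comp_assoc -flat_nat rep_flat.
by rewrite -!comp_assoc -tensM_rl -tensM_lr.
Qed.

Lemma rep_tens (a a' b b' : tree) (f : Hom (obj a) (obj a'))
    (g : Hom (obj b) (obj b')) x :
  rep (a := node a b) (b := node a' b') (f ⊗₁ g) x
  = rep f (act b' x) ∘ actM a (rep g x).
Proof.
apply: rep_unique => /=.
rewrite -!comp_assoc assoc_nat (comp_assoc (actM _ _)) -flat_nat -comp_assoc.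
rewrite (comp_assoc (rep _ _)) rep_flat -!comp_assoc; congr (_ ∘ _).
rewrite !comp_assoc; congr (_ ∘ _).
by rewrite -!tensM_comp !comp_idl !comp_idr rep_flat.
Qed.

(** This is the pentagon. *)
Lemma rep_assoc (a b c : tree) (x : C) :
  rep (a := node (node a b) c) (b := node a (node b c))
    (assoc (obj a) (obj b) (obj c)) x = idm _.
Proof.
apply: rep_unique => /=.
rewrite comp_idl -!comp_assoc; congr (_ ∘ _).
rewrite !comp_assoc !tensM_compr -!comp_assoc.
rewrite [in LHS]comp_assoc.
have -> : (idm (obj a) ⊗₁ assoc (obj b) (obj c) x) ∘
  (assoc (obj a) (obj b ⊗ obj c) x ∘ (assoc (obj a) (obj b) (obj c) ⊗₁ idm x)) =
  (assoc (obj a) (obj b) (obj c ⊗ x) ∘ assoc (obj a ⊗ obj b) (obj c) x).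
  by rewrite pentagon comp_assoc.
rewrite -!comp_assoc; congr (_ ∘ _).
by rewrite !comp_assoc -tensM_id assoc_nat.
Qed.

Lemma rep_assocV (a b c : tree) (x : C) :
  rep (a := node a (node b c)) (b := node (node a b) c)
    (bwd (assoc (obj a) (obj b) (obj c))) x = idm _.
Proof.
have := rep_comp (a := node (node a b) c) (b := node a (node b c))
  (c := node (node a b) c) (bwd (assoc (obj a) (obj b) (obj c)))
  (assoc (obj a) (obj b) (obj c)) x.
by rewrite bwd_fwd (rep_id (node (node a b) c)) rep_assoc comp_idr => <-.
Qed.

(** Both unit constraints act as identities: the left one by [lunit_tens], the
    right one by the triangle. *)
Lemma rep_lunit (a : tree) (x : C) :
  rep (a := node tunit a) (b := a) (lunit (obj a)) x = idm _.
Proof.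
apply: rep_unique => /=.
by rewrite comp_idl -lunit_tens !comp_assoc lunit_nat.
Qed.

Lemma rep_runit (a : tree) (x : C) :
  rep (a := node a tunit) (b := a) (runit (obj a)) x = idm _.
Proof.
apply: rep_unique => /=.
by rewrite comp_idl -triangle.
Qed.

Context {B : Braiding T}.

Definition rep_braid (a b : tree) (x : C) : Hom (act a (act b x)) (act b (act a x)) :=
  rep (a := node a b) (b := node b a) (braid (obj a) (obj b)) x.

Lemma rep_braid_nat (a b : tree) (x y : C) (h : Hom x y) :
  rep_braid a b y ∘ actM a (actM b h) = actM b (actM a h) ∘ rep_braid a b x.
Proof. exact: eq_sym (rep_nat (a := node a b) (b := node b a) _ h). Qed.

(** In the model the hexagons lose their associators: to braid a tensor product
    is to braid its factors in turn. *)
Lemma rep_braid_nodel (a b c : tree) (x : C) :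
  rep_braid (node a b) c x = rep_braid a c (act b x) ∘ actM a (rep_braid b c x).
Proof.
have e := f_equal (fun f => rep (a := node a (node b c)) (b := node (node c a) b) f x)
  (hexagon2 (Braiding := B) (obj a) (obj b) (obj c)); move: e; cbv beta.
rewrite (rep_comp (b := node (node a b) c)) (rep_comp (b := node c (node a b))).
rewrite (rep_comp (b := node a (node c b)) (_ ∘ _)) (rep_comp (b := node (node a c) b)).
by rewrite !rep_assocV !rep_tens !rep_id actM_id comp_idl !comp_idr comp_idl.
Qed.

Lemma rep_braid_noder (a b c : tree) (x : C) :
  rep_braid a (node b c) x = actM b (rep_braid a c x) ∘ rep_braid a b (act c x).
Proof.
have e := f_equal (fun f => rep (a := node (node a b) c) (b := node b (node c a)) f x)
  (hexagon1 (Braiding := B) (obj a) (obj b) (obj c)); move: e; cbv beta.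
rewrite (rep_comp (b := node a (node b c))) (rep_comp (b := node (node b c) a)).
rewrite (rep_comp (b := node (node b a) c) (_ ∘ _)) (rep_comp (b := node b (node a c))).
by rewrite !rep_assoc !rep_tens !rep_id actM_id !comp_idl !comp_idr.
Qed.

Lemma rep_exch (a b c d : tree) (x : C) :
  rep (a := node (node a b) (node c d)) (b := node (node a c) (node b d))
    (exch (obj a) (obj b) (obj c) (obj d)) x = actM a (rep_braid b c (act d x)).
Proof.
rewrite /exch (rep_comp (b := node a (node b (node c d)))).
rewrite (rep_comp (b := node a (node c (node b d)))).
rewrite rep_assoc rep_assocV comp_idl comp_idr rep_tens rep_id comp_idl.
rewrite (rep_comp (b := node (node b c) d)) (rep_comp (b := node (node c b) d)).
by rewrite rep_assoc rep_assocV comp_idl comp_idr rep_tens rep_id actM_id comp_idr.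
Qed.

(** [⊗ : C × C → C] with [exch] satisfies the associativity of a monoidal
    functor.  In the model both sides move [b] past [a'] and then [m] past
    [a' ⊗ b'], up to the order of two disjoint crossings. *)
Lemma exch_assoc (a a' b b' m p : C) :
  (assoc a b m ⊗₁ assoc a' b' p) ∘ exch (a ⊗ b) (a' ⊗ b') m p
    ∘ (exch a a' b b' ⊗₁ idm (m ⊗ p))
  = exch a a' (b ⊗ m) (b' ⊗ p) ∘ (idm (a ⊗ a') ⊗₁ exch b b' m p)
    ∘ assoc (a ⊗ a') (b ⊗ b') (m ⊗ p).
Proof.
pose A := leaf a; pose A' := leaf a'; pose D := leaf b; pose D' := leaf b'.
pose M := leaf m; pose P := leaf p.
apply: (@rep_faithful (node (node (node A A') (node D D')) (node M P))
   (node (node A (node D M)) (node A' (node D' P)))) => x.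
rewrite (rep_comp (b := node (node (node A D) (node A' D')) (node M P))).
rewrite (rep_comp (b := node (node (node A D) M) (node (node A' D') P))).
rewrite (rep_comp (b := node (node A A') (node (node D D') (node M P))) (_ ∘ _)).
rewrite (rep_comp (b := node (node A A') (node (node D M) (node D' P)))).
rewrite (rep_tens (a := node (node A D) M) (b := node (node A' D') P)
   (a' := node A (node D M)) (b' := node A' (node D' P))).
rewrite (rep_assoc (node A A') (node D D') (node M P)).
rewrite (rep_assoc A D M) (rep_assoc A' D' P) actM_id !comp_idl comp_idr.
rewrite (rep_exch (node A D) (node A' D') M P) (rep_exch A A' (node D M) (node D' P)).
rewrite (rep_tens (a := node (node A A') (node D D')) (b := node M P)
   (a' := node (node A D) (node A' D')) (b' := node M P)).
rewrite (rep_tens (a := node A A') (b := node (node D D') (node M P))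
   (a' := node A A') (b' := node (node D M) (node D' P))).
rewrite (rep_id (node M P)) (rep_id (node A A')) actM_id comp_idr comp_idl.
rewrite (rep_exch A A' D D') (rep_exch D D' M P).
rewrite rep_braid_nodel rep_braid_noder.
rewrite [actM (node A D) _]/= -!tensM_compr; congr (_ ⊗₁ _).
rewrite -!comp_assoc tensM_compr -comp_assoc; congr (_ ∘ _).
by rewrite (rep_braid_nat A' D).
Qed.

Context (symB : is_symmetric B).

Lemma rep_braidK (a b : tree) (x : C) : rep_braid b a x ∘ rep_braid a b x = idm _.
Proof.
transitivity (rep (a := node a b) (b := node a b)
  (braid (obj b) (obj a) ∘ braid (obj a) (obj b)) x).
- by symmetry; apply: (rep_comp (a := node a b) (b := node b a) (c := node a b)).
- by rewrite symB; apply: (rep_id (node a b)).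
Qed.

Lemma exchK (a b c d : C) : exch a c b d ∘ exch a b c d = idm _.
Proof.
pose X := leaf a; pose Y := leaf b; pose Z := leaf c; pose W := leaf d.
apply: (@rep_faithful (node (node X Y) (node Z W)) (node (node X Y) (node Z W))) => x.
rewrite (rep_comp (b := node (node X Z) (node Y W))).
rewrite (rep_exch X Y Z W) (rep_exch X Z Y W).
transitivity (actM X (rep_braid Z Y (act W x) ∘ rep_braid Y Z (act W x))).
- by rewrite actM_comp.
- by rewrite rep_braidK actM_id (rep_id (node (node X Y) (node Z W))).
Qed.

(** By the hexagon and naturality for [K ⊗ K ≅ K], braiding with the unit
    object is idempotent; being invertible, it is the identity. *)
Lemma rep_braid_unitr (a : tree) (x : C) : rep_braid a tunit x = idm _.
Proof.
have e : rep_braid a tunit x ∘ rep_braid a tunit x = rep_braid a tunit x.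
  rewrite -[LHS](rep_braid_noder a tunit tunit x).
  have e := f_equal (fun f => rep (a := node a (node tunit tunit)) (b := node tunit a) f x)
    (braid_nat (Braiding := B) (idm (obj a)) (lunit munit)); move: e; cbv beta.
  rewrite (rep_comp (b := node a tunit)) (rep_comp (b := node (node tunit tunit) a)).
  rewrite (rep_tens (a := a) (a' := a) (b := node tunit tunit) (b' := tunit)).
  rewrite (rep_tens (a := node tunit tunit) (a' := tunit) (b := a) (b' := a)).
  rewrite !rep_id !(rep_lunit tunit) !actM_id !comp_idl comp_idr => e.
  exact: eq_sym e.
transitivity (rep_braid tunit a x ∘ rep_braid a tunit x ∘ rep_braid a tunit x).
- by rewrite rep_braidK comp_idl.
- by rewrite -comp_assoc e rep_braidK.
Qed.

Lemma rep_braid_unitl (a : tree) (x : C) : rep_braid tunit a x = idm _.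
Proof.
have e := rep_braidK a tunit x.
by rewrite rep_braid_unitr comp_idr in e.
Qed.

Lemma braid_exch (a b c d : C) :
  braid (a ⊗ c) (b ⊗ d) ∘ exch a b c d = exch b a d c ∘ (braid a b ⊗₁ braid c d).
Proof.
pose X := leaf a; pose Y := leaf b; pose Z := leaf c; pose W := leaf d.
apply: (@rep_faithful (node (node X Y) (node Z W)) (node (node Y W) (node X Z))) => x.
rewrite (rep_comp (b := node (node X Z) (node Y W))).
rewrite (rep_comp (b := node (node Y X) (node W Z))).
rewrite (rep_exch X Y Z W) (rep_exch Y X W Z).
rewrite (rep_tens (a := node X Y) (a' := node Y X) (b := node Z W) (b' := node W Z)).
change (rep_braid (node X Z) (node Y W) x ∘ actM X (rep_braid Y Z (act W x)) =
  actM Y (rep_braid X W (act Z x)) ∘ (rep_braid X Y (act W (act Z x))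
    ∘ actM (node X Y) (rep_braid Z W x))).
rewrite rep_braid_nodel !rep_braid_noder !actM_comp -!comp_assoc.
rewrite -[in LHS]actM_comp.
by rewrite rep_braidK actM_id comp_idr.
Qed.

Lemma exch_unitm (a b c : C) :
  (runit a ⊗₁ idm (b ⊗ c)) ∘ exch a b munit c
  = assoc a b c ∘ (idm (a ⊗ b) ⊗₁ lunit c).
Proof.
pose X := leaf a; pose Y := leaf b; pose Z := leaf c.
apply: (@rep_faithful (node (node X Y) (node tunit Z)) (node X (node Y Z))) => x.
rewrite (rep_comp (b := node (node X tunit) (node Y Z))).
rewrite (rep_comp (b := node (node X Y) Z)).
rewrite (rep_exch X Y tunit Z) rep_braid_unitr.
rewrite (rep_tens (a := node X tunit) (a' := X) (b := node Y Z) (b' := node Y Z)).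
rewrite (rep_tens (a := node X Y) (a' := node X Y) (b := node tunit Z) (b' := Z)).
rewrite (rep_id (node _ _)) (rep_id (node _ _)) (rep_lunit Z) (rep_runit X).
by rewrite (rep_assoc X Y Z) !actM_id !comp_idl.
Qed.

Lemma exch_unitl (c d : C) :
  (lunit c ⊗₁ lunit d) ∘ exch munit munit c d
  = lunit (c ⊗ d) ∘ (lunit munit ⊗₁ idm (c ⊗ d)).
Proof.
pose Z := leaf c; pose W := leaf d; pose U := tunit.
apply: (@rep_faithful (node (node U U) (node Z W)) (node Z W)) => x.
rewrite (rep_comp (b := node (node U Z) (node U W))).
rewrite (rep_comp (b := node U (node Z W))).
rewrite (rep_exch U U Z W) rep_braid_unitl.
rewrite (rep_tens (a := node U Z) (a' := Z) (b := node U W) (b' := W)).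
rewrite (rep_tens (a := node U U) (a' := U) (b := node Z W) (b' := node Z W)).
rewrite (rep_id (node _ _)) (rep_lunit Z) (rep_lunit W) (rep_lunit U).
by rewrite (rep_lunit (node Z W)) !actM_id !comp_idl.
Qed.

Lemma lunit_braid (a : C) : lunit a ∘ braid a munit = runit a.
Proof.
pose X := leaf a.
apply: (@rep_faithful (node X tunit) X) => x.
rewrite (rep_comp (b := node tunit X)) (rep_lunit X) (rep_runit X).
by rewrite comp_idl; apply: (rep_braid_unitr X x).
Qed.

Lemma lunit_munit : fwd (lunit munit) = fwd (runit munit).
Proof.
apply: (@rep_faithful (node tunit tunit) tunit) => x.
by rewrite (rep_lunit tunit) (rep_runit tunit).
Qed.

Lemma bwd_assoc_nat (a b c a' b' c' : C) (f : Hom a a') (g : Hom b b')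
    (h : Hom c c') :
  bwd (assoc a' b' c') ∘ (f ⊗₁ (g ⊗₁ h)) = ((f ⊗₁ g) ⊗₁ h) ∘ bwd (assoc a b c).
Proof.
apply: (@iso_cancell _ _ _ (assoc a' b' c')).
by rewrite !comp_assoc assoc_nat fwd_bwd comp_idl -comp_assoc fwd_bwd comp_idr.
Qed.

Lemma runit_tens (a b : C) :
  (idm a ⊗₁ runit b) ∘ assoc a b munit = runit (a ⊗ b).
Proof.
pose X := leaf a; pose Y := leaf b; pose U := tunit.
apply: (@rep_faithful (node (node X Y) U) (node X Y)) => x.
rewrite (rep_comp (b := node X (node Y U))).
rewrite (rep_tens (a := X) (a' := X) (b := node Y U) (b' := Y)).
rewrite (rep_id X) (rep_runit Y) (rep_runit (node X Y)) (rep_assoc X Y U).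
by rewrite !actM_id !comp_idl.
Qed.

Lemma exch_nat (a b c d a' b' c' d' : C) (f : Hom a a') (g : Hom b b')
    (h : Hom c c') (k : Hom d d') :
  exch a' b' c' d' ∘ ((f ⊗₁ g) ⊗₁ (h ⊗₁ k)) = ((f ⊗₁ h) ⊗₁ (g ⊗₁ k)) ∘ exch a b c d.
Proof.
rewrite /exch -comp_assoc assoc_nat !comp_assoc -bwd_assoc_nat.
rewrite -!comp_assoc; congr (_ ∘ _).
rewrite !comp_assoc -!tensM_comp comp_idl comp_idr; congr ((_ ⊗₁ _) ∘ _).
rewrite -!comp_assoc bwd_assoc_nat !comp_assoc -assoc_nat.
rewrite -!comp_assoc; congr (_ ∘ _).
by rewrite !comp_assoc -!tensM_comp braid_nat comp_idl comp_idr.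
Qed.

End Monoidal.

Unset SsrRewrite.

Section Exchange.
Context {C : Category} {T : Monoidal C} {B : Braiding T} (symB : is_symmetric B).

Definition exch_iso (a b c d : C) : Iso ((a ⊗ b) ⊗ (c ⊗ d)) ((a ⊗ c) ⊗ (b ⊗ d)) :=
  {| fwd := exch a b c d; bwd := exch a c b d;
     bwd_fwd := exchK symB a b c d; fwd_bwd := exchK symB a c b d |}.

(** The inverse of the diagram [exch_assoc], as [exch] is its own inverse. *)
Lemma exch_coassoc (a b m a' b' p : C) :
  assoc (a ⊗ a') (b ⊗ b') (m ⊗ p) ∘ (exch a b a' b' ⊗₁ idm (m ⊗ p))
    ∘ exch (a ⊗ b) m (a' ⊗ b') p
  = (idm (a ⊗ a') ⊗₁ exch b m b' p) ∘ exch a (b ⊗ m) a' (b' ⊗ p)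
    ∘ (assoc a b m ⊗₁ assoc a' b' p).
Proof.
apply: (iso_cancelr (i := iso_comp (exch_iso (a ⊗ b) (a' ⊗ b') m p)
  (iso_tens (exch_iso a a' b b') (iso_id (m ⊗ p))))).
transitivity (fwd (assoc (a ⊗ a') (b ⊗ b') (m ⊗ p))).
- simpl. rewrite <- !comp_assoc, (comp_eqr (exchK symB _ _ _ _)), comp_idl.
  now rewrite <- tensM_comp, exchK, comp_idl, tensM_id, comp_idr.
- simpl. rewrite <- !comp_assoc, (comp_assoc (assoc _ _ _ ⊗₁ _)), exch_assoc.
  rewrite <- !comp_assoc, (comp_eqr (exchK symB _ _ _ _)), comp_idl.
  now rewrite comp_assoc, <- tensM_comp, exchK, comp_idl, tensM_id, comp_idl.
Qed.

End Exchange.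

(** * Modules over a Hopf algebra *)

Ltac rnest := rewrite <- ?comp_assoc.
(** [fuse] merges adjacent tensor products of morphisms, so that two composites
    that differ by the interchange law become equal. *)
Ltac fuse :=
  rnest; repeat first [rewrite <- tensM_comp | rewrite tensM_comp_eqr];
  rewrite ?tensM_id, ?comp_idl, ?comp_idr; rnest.

Section Actions.
Context {C : Category} {T : Monoidal C} {B : Braiding T}.

(** If [E] and then [D] act, [D ⊗ E] acts by [(d ⊗ e) m = d (e m)].  The diagonal
    form of this action, for the coproduct of the coalgebra [D ⊗ E], is the
    composite of the diagonal actions.  It is used for [D = E], where it gives
    associativity, and for the pair [H], [A]. *)
Lemma tens_action_comp (D E : HopfAlgebra B) (M P : C)
    (phiM : Hom (E ⊗ M) M) (phiP : Hom (E ⊗ P) P)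
    (psiM : Hom (D ⊗ M) M) (psiP : Hom (D ⊗ P) P) :
  tens_action psiM psiP ∘ (idm D ⊗₁ tens_action phiM phiP) ∘ assoc D E (M ⊗ P)
  = ((psiM ∘ (idm D ⊗₁ phiM) ∘ assoc D E M) ⊗₁ (psiP ∘ (idm D ⊗₁ phiP) ∘ assoc D E P))
    ∘ exch (D ⊗ E) (D ⊗ E) M P ∘ ((exch D D E E ∘ (delta D ⊗₁ delta E)) ⊗₁ idm (M ⊗ P)).
Proof.
rewrite !tensM_comp, tensM_compl; rnest.
rewrite (comp_eqr3 (exch_assoc _ _ _ _ _ _)); rnest.
rewrite assoc_nat, (comp_eqr (eq_sym (exch_nat _ _ _ _))).
unfold tens_action. now fuse.
Qed.

Section Module.
Context (symB : is_symmetric B) (D : HopfAlgebra B).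

Lemma tens_action_module (M P : C)
   (phiM : Hom (D ⊗ M) M) (phiP : Hom (D ⊗ P) P) :
  is_module phiM -> is_module phiP -> is_module (tens_action phiM phiP).
Proof.
intros [uM aM] [uP aP]; split.
- unfold tens_action; rnest.
  rewrite <- tensM_compl, (algmor_unit (hopf_delta_mor D)); unfold tens_eta.
  rewrite tensM_compl, <- (tensM_id M P).
  rewrite (comp_eqr (exch_nat _ _ _ _)). rnest.
  rewrite (comp_eqr (eq_sym (tensM_comp _ _ _ _))), uM, uP.
  rewrite comp_assoc, (exch_unitl symB), tensM_id; rnest.
  now rewrite <- tensM_compl, fwd_bwd, tensM_id, comp_idr.
- rewrite tens_action_comp, <- aM, <- aP.
  unfold tens_action; rnest.
  rewrite <- tensM_compl, (algmor_mul (hopf_delta_mor D)); unfold tens_mu.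
  rewrite tensM_comp; rnest.
  rewrite (comp_eqr (eq_sym (exch_nat _ _ _ _))). now fuse.
Qed.

Lemma module_mor_inv (M M' : C) (phi : Hom (D ⊗ M) M) (phi' : Hom (D ⊗ M') M')
    (f : Iso M M') : is_module_mor phi phi' f -> is_module_mor phi' phi (bwd f).
Proof.
unfold is_module_mor; intros e.
apply (iso_cancell (i := f)).
rewrite !comp_assoc, fwd_bwd, comp_idl, e. rnest.
now rewrite <- tensM_compr, fwd_bwd, tensM_id, comp_idr.
Qed.

Lemma tens_module_mor (M M' P P' : C)
    (phiM : Hom (D ⊗ M) M) (phiM' : Hom (D ⊗ M') M')
    (phiP : Hom (D ⊗ P) P) (phiP' : Hom (D ⊗ P') P') (f : Hom M M') (g : Hom P P') :
  is_module_mor phiM phiM' f -> is_module_mor phiP phiP' g ->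
  is_module_mor (tens_action phiM phiP) (tens_action phiM' phiP') (f ⊗₁ g).
Proof.
unfold is_module_mor, tens_action; intros ef eg. rnest.
rewrite tensM_comp_eqr, ef, eg, tensM_comp. rnest.
rewrite (comp_eqr (eq_sym (exch_nat _ _ _ _))). now fuse.
Qed.

(** An iterated diagonal action first applies an iterated coproduct; for the two
    bracketings these are the two sides of coassociativity. *)
Lemma tens_action_tensl (M P Q : C)
   (phiM : Hom (D ⊗ M) M) (phiP : Hom (D ⊗ P) P) (phiQ : Hom (D ⊗ Q) Q) :
  tens_action (tens_action phiM phiP) phiQ
  = ((phiM ⊗₁ phiP) ⊗₁ phiQ) ∘ ((exch D D M P ⊗₁ idm (D ⊗ Q))
      ∘ exch (D ⊗ D) D (M ⊗ P) Q)
    ∘ (((delta D ⊗₁ idm D) ∘ delta D) ⊗₁ idm ((M ⊗ P) ⊗ Q)).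
Proof.
rewrite tensM_compl, <- (tensM_id (M ⊗ P) Q); rnest.
rewrite (comp_eqr (exch_nat _ _ _ _)).
unfold tens_action. now fuse.
Qed.

Lemma tens_action_tensr (M P Q : C)
   (phiM : Hom (D ⊗ M) M) (phiP : Hom (D ⊗ P) P) (phiQ : Hom (D ⊗ Q) Q) :
  tens_action phiM (tens_action phiP phiQ)
  = (phiM ⊗₁ (phiP ⊗₁ phiQ)) ∘ ((idm (D ⊗ M) ⊗₁ exch D D P Q)
      ∘ exch D (D ⊗ D) M (P ⊗ Q))
    ∘ (((idm D ⊗₁ delta D) ∘ delta D) ⊗₁ idm (M ⊗ (P ⊗ Q))).
Proof.
rewrite tensM_compl, <- (tensM_id M (P ⊗ Q)); rnest.
rewrite (comp_eqr (exch_nat _ _ _ _)).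
unfold tens_action. now fuse.
Qed.

Lemma assoc_module_mor (M P Q : C)
   (phiM : Hom (D ⊗ M) M) (phiP : Hom (D ⊗ P) P) (phiQ : Hom (D ⊗ Q) Q) :
  is_module_mor (tens_action (tens_action phiM phiP) phiQ)
    (tens_action phiM (tens_action phiP phiQ)) (assoc M P Q).
Proof.
unfold is_module_mor.
rewrite tens_action_tensl, tens_action_tensr; rnest.
rewrite (comp_eqr (assoc_nat _ _ _)); rnest.
rewrite (comp_eqr3 (exch_coassoc symB _ _ _ _ _ _)); rnest.
rewrite <- !tensM_comp, comp_idr, comp_idl.
now rewrite !comp_assoc, (coalg_coassoc (hopf_coalgebra D)), comp_idr.
Qed.

Lemma counit_mu : is_module_mor (mu D) (triv_action D) (eps D).
Proof.
unfold is_module_mor, triv_action.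
rewrite (algmor_mul (hopf_eps_mor D)), lunit_munit, <- runit_nat; rnest.
now fuse.
Qed.

Lemma triv_module : is_module (triv_action D).
Proof.
split.
- unfold triv_action; rnest.
  rewrite runit_nat, comp_assoc, (algmor_unit (hopf_eps_mor D)), comp_idl.
  symmetry; exact lunit_munit.
- pose proof counit_mu as e; unfold is_module_mor in e.
  unfold triv_action at 3. rewrite tensM_compr.
  rewrite <- (comp_assoc _ _ (assoc _ _ _)), <- (comp_assoc _ _ (assoc _ _ _)), runit_tens.
  rewrite comp_assoc, <- e. unfold triv_action; rnest.
  now rewrite runit_nat.
Qed.

(** This is the counit law, once the unit factor is moved out of [exch]. *)
Lemma lunit_module_mor (M : C) (phiM : Hom (D ⊗ M) M) :
  is_module_mor (tens_action (triv_action D) phiM) phiM (lunit M).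
Proof.
unfold is_module_mor, tens_action, triv_action.
transitivity (phiM ∘ (lunit (D ⊗ M) ∘ ((eps D ⊗₁ idm (D ⊗ M)) ∘
  ((runit D ⊗₁ idm (D ⊗ M)) ∘ exch D D munit M ∘ (delta D ⊗₁ idm (munit ⊗ M)))))).
- rewrite (comp_eqr (eq_sym (lunit_nat _))). now fuse.
- rewrite (exch_unitm symB), <- (tensM_id D M); rnest.
  rewrite (comp_eqr (eq_sym (assoc_nat _ _ _))); rnest.
  rewrite (comp_eqr (lunit_tens _ _)); f_equal; fuse.
  rewrite comp_assoc.
  now rewrite (coalg_counitl (hopf_coalgebra D)).
Qed.

Section Cocommutative.
Context (cocomm : is_cocommutative D).

Lemma braid_module_mor (M P : C) (phiM : Hom (D ⊗ M) M) (phiP : Hom (D ⊗ P) P) :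
  is_module_mor (tens_action phiM phiP) (tens_action phiP phiM) (braid M P).
Proof.
unfold is_module_mor, tens_action; rnest.
rewrite (comp_eqr (braid_nat _ _)); rnest.
rewrite (comp_eqr (braid_exch symB _ _ _ _)); rnest.
now rewrite <- !tensM_comp, cocomm, !comp_idr, comp_idl.
Qed.

Lemma runit_module_mor (M : C) (phiM : Hom (D ⊗ M) M) :
  is_module_mor (tens_action phiM (triv_action D)) phiM (runit M).
Proof.
rewrite <- (lunit_braid symB).
exact (is_module_mor_comp (lunit_module_mor phiM) (braid_module_mor _ _)).
Qed.

(** Cocommutativity makes [δ] a morphism of coalgebras from [D] to [D ⊗ D]: by
    coassociativity, the two middle factors of the fourfold coproduct, which
    [exch] permutes, come from a single coproduct. *)
Lemma delta_comul :
  exch D D D D ∘ (delta D ⊗₁ delta D) ∘ delta D = (delta D ⊗₁ delta D) ∘ delta D.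
Proof.
assert (E : (delta D ⊗₁ delta D) ∘ delta D =
  bwd (assoc D D (D ⊗ D)) ∘ (idm D ⊗₁ (assoc D D D ∘ (delta D ⊗₁ idm D) ∘ delta D)) ∘ delta D).
{ apply (iso_cancell (i := assoc D D (D ⊗ D))).
  rewrite (coalg_coassoc (hopf_coalgebra D)).
  rewrite tensM_rl, <- tensM_id; rnest.
  rewrite (comp_eqr (assoc_nat _ _ _)); rnest.
  rewrite (comp_assoc _ _ (delta D)).
  rewrite (comp_assoc (assoc _ _ _)), (coalg_coassoc (hopf_coalgebra D)).
  rewrite !fwd_bwd, comp_idl. now fuse. }
rnest. rewrite E. unfold exch; rnest.
rewrite (comp_eqr (fwd_bwd _)), comp_idl.
rewrite (comp_eqr (eq_sym (tensM_compr _ _ _))). rnest.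
rewrite (comp_eqr (bwd_fwd _)), comp_idl.
rewrite (comp_eqr (eq_sym (tensM_compl _ _ _))), cocomm.
reflexivity.
Qed.
End Cocommutative.
End Module.

(** * Linearity of the coalgebra structure of [H] *)

Section Cocycle.
Context (symB : is_symmetric B) (A H : HopfAlgebra B).
Context (cocomm : is_cocommutative A).
Context (pi : Hom A H) (coalg_pi : is_coalgebra_mor (eps A) (delta A) (eps H) (delta H) pi).

(** The map [a ⊗ m ↦ π(a₁) * (a₂.m)], by which [A] acts on the object [N] of a
    module over the cocycle when [N] is identified with [M] through [γ]. *)
Definition cocycle_action (M : C) (phi : Hom (A ⊗ M) M) (psi : Hom (H ⊗ M) M) :
    Hom (A ⊗ M) M :=
  psi ∘ (pi ⊗₁ phi) ∘ assoc A A M ∘ (delta A ⊗₁ idm M).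

(** The map is the action of [H ⊗ A] restricted along [a ↦ π(a₁) ⊗ a₂], which
    puts it in the scope of [tens_action_comp]. *)
Lemma cocycle_action_factor (M : C) (phi : Hom (A ⊗ M) M) (psi : Hom (H ⊗ M) M) :
  cocycle_action phi psi =
  psi ∘ (idm H ⊗₁ phi) ∘ assoc H A M ∘ (((pi ⊗₁ idm A) ∘ delta A) ⊗₁ idm M).
Proof.
unfold cocycle_action.
rewrite tensM_compl; rnest.
rewrite (comp_eqr (assoc_nat _ _ _)). now fuse.
Qed.

Lemma cocycle_action_precomp (M X : C) (phi : Hom (A ⊗ M) M) (psi : Hom (H ⊗ M) M)
    (h : Hom X M) :
  cocycle_action phi psi ∘ (idm A ⊗₁ h)
  = psi ∘ (pi ⊗₁ (phi ∘ (idm A ⊗₁ h))) ∘ assoc A A X ∘ (delta A ⊗₁ idm X).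
Proof.
unfold cocycle_action.
transitivity (psi ∘ (pi ⊗₁ phi) ∘ (idm A ⊗₁ (idm A ⊗₁ h)) ∘ assoc A A X ∘ (delta A ⊗₁ idm X)).
- rnest. rewrite (comp_eqr (eq_sym (assoc_nat _ _ _))). now fuse.
- now fuse.
Qed.

Lemma cocycle_action_triv :
  cocycle_action (triv_action A) (triv_action H) = triv_action A.
Proof.
unfold cocycle_action.
transitivity (triv_action H ∘ (pi ⊗₁ eps A) ∘ ((idm A ⊗₁ runit A) ∘ assoc A A munit)
  ∘ (delta A ⊗₁ idm munit)).
{ unfold triv_action at 2. now fuse. }
rewrite runit_tens; rnest. rewrite runit_nat.
unfold triv_action. rewrite (tensM_lr pi); rnest.
rewrite (comp_eqr (runit_nat _)); rnest.
rewrite (comp_assoc (eps H)), (coalgmor_counit coalg_pi). f_equal.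
now rewrite !comp_assoc, (coalg_counitr (hopf_coalgebra A)), comp_idl.
Qed.

(** The map [a ↦ π(a₁) ⊗ a₂] is a coalgebra morphism by [delta_comul], so
    restriction along it respects diagonal actions. *)
Lemma cocycle_action_tens (M P : C)
   (phiM : Hom (A ⊗ M) M) (phiP : Hom (A ⊗ P) P)
   (psiM : Hom (H ⊗ M) M) (psiP : Hom (H ⊗ P) P) :
  cocycle_action (tens_action phiM phiP) (tens_action psiM psiP)
  = tens_action (cocycle_action phiM psiM) (cocycle_action phiP psiP).
Proof.
rewrite !cocycle_action_factor, tens_action_comp.
set (r := (pi ⊗₁ idm A) ∘ delta A).
assert (E : exch H H A A ∘ (delta H ⊗₁ delta A) ∘ r = (r ⊗₁ r) ∘ delta A).
{ unfold r. rewrite tensM_comp; rnest.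
  rewrite <- (delta_comul cocomm); rnest.
  rewrite (comp_eqr (eq_sym (exch_nat _ _ _ _))); fuse.
  rewrite (coalgmor_comul coalg_pi). now fuse. }
rnest. rewrite <- tensM_compl, E, tensM_compl.
rewrite <- (tensM_id M P), (comp_eqr (exch_nat _ _ _ _)).
unfold tens_action. now fuse.
Qed.

(** The operation [f ↦ (a ⊗ x ↦ π(a₁) * f(a₂ ⊗ x))] is undone by the same
    operation with [λ_H ∘ π] in place of [π], since
    [λ_H(π(a₁)) π(a₂) = ε(a) 1]. *)
Lemma cocycle_action_cancel (Q X : C) (tau : Hom (H ⊗ Q) Q) (f g : Hom (A ⊗ X) Q) :
  is_module tau ->
  tau ∘ (pi ⊗₁ f) ∘ assoc A A X ∘ (delta A ⊗₁ idm X)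
  = tau ∘ (pi ⊗₁ g) ∘ assoc A A X ∘ (delta A ⊗₁ idm X) -> f = g.
Proof.
intros [unit_tau assoc_tau].
(* [E] recovers [f] from the operation applied to it. *)
assert (E : forall f : Hom (A ⊗ X) Q, f =
  tau ∘ ((antipode H ∘ pi) ⊗₁ (tau ∘ (pi ⊗₁ f) ∘ assoc A A X ∘ (delta A ⊗₁ idm X)))
   ∘ assoc A A X ∘ (delta A ⊗₁ idm X)).
2: intros e; now rewrite (E f), (E g), e.
clear f g; intros f. symmetry.
transitivity (tau ∘ (idm H ⊗₁ tau) ∘ assoc H H Q ∘
   (((antipode H ∘ pi) ⊗₁ pi) ⊗₁ f) ∘ assoc (A ⊗ A) A X
   ∘ (((delta A ⊗₁ idm A) ∘ delta A) ⊗₁ idm X)).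
{ rnest. rewrite (comp_eqr (assoc_nat _ _ _)); rnest.
  rewrite (comp_eqr (pentagon _ _ _ _)); rnest.
  rewrite <- tensM_compl, comp_assoc with (f := delta A).
  rewrite (coalg_coassoc (hopf_coalgebra A)).
  rewrite tensM_compl.
  rewrite (comp_eqr (assoc_nat _ _ _)); rnest. now fuse. }
rewrite <- assoc_tau; rnest.
rewrite tensM_compl, (comp_eqr (assoc_nat _ _ _)), tensM_id.
fuse.
replace (mu H ∘ (((antipode H ∘ pi) ⊗₁ pi) ∘ delta A)) with (eta H ∘ eps A).
2:{ transitivity (convolution (delta H) (mu H) (antipode H) (idm H) ∘ pi).
  - rewrite (hopf_antipodel H). rnest. now rewrite (coalgmor_counit coalg_pi).
  - unfold convolution; rnest. rewrite (coalgmor_comul coalg_pi). now fuse. }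
transitivity (tau ∘ (eta H ⊗₁ idm Q) ∘ (idm munit ⊗₁ f) ∘ (eps A ⊗₁ idm (A ⊗ X)) ∘ (assoc A A X ∘ (delta A ⊗₁ idm X))).
{ now fuse. }
rewrite unit_tau, lunit_nat, <- tensM_id; rnest.
rewrite (comp_eqr (eq_sym (assoc_nat _ _ _))); rnest.
rewrite (comp_eqr (lunit_tens _ _)), <- !tensM_compl, comp_assoc.
now rewrite (coalg_counitl (hopf_coalgebra A)), tensM_id, comp_idr.
Qed.

Context (phiH : Hom (A ⊗ H) H).
Context (cocycle : is_invertible_cocycle phiH pi).

Lemma mu_module : is_module (A := H) (mu H).
Proof. split; apply (hopf_algebra H). Qed.

Lemma pi_cocycle_action : pi ∘ mu A = cocycle_action phiH (mu H) ∘ (idm A ⊗₁ pi).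
Proof.
unfold cocycle_action. rewrite (cocycle_mul cocycle). now fuse.
Qed.

Lemma pi_epi (a : C) (f g : Hom (A ⊗ H) a) :
  f ∘ (idm A ⊗₁ pi) = g ∘ (idm A ⊗₁ pi) -> f = g.
Proof.
destruct (cocycle_iso cocycle) as [q [qp pq]]; intros e.
rewrite <- (comp_idr f), <- (comp_idr g), <- tensM_id, <- pq, tensM_compr.
now rewrite !comp_assoc, e.
Qed.

(** It suffices to compare the two sides under [π(a₁) * -], with [H] acting
    diagonally on [H ⊗ H] by multiplication, and with [π(b)] as the argument.
    Both give [δ_H (π (a b))]: one side because [δ_H] is multiplicative, the
    other because [π] and [μ_A] are compatible with the coproducts. *)
Lemma delta_module_mor : is_module_mor phiH (tens_action phiH phiH) (delta H).
Proof.
unfold is_module_mor.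
apply (cocycle_action_cancel (tens_action_module symB mu_module mu_module)).
apply pi_epi.
transitivity (delta H ∘ pi ∘ mu A).
{ rnest. rewrite pi_cocycle_action. unfold cocycle_action; rnest.
  rewrite (comp_assoc (delta H) (mu H)), (algmor_mul (hopf_delta_mor H)).
  unfold tens_action, tens_mu; fuse. reflexivity. }
(* The right-hand side is the cocycle action on [H ⊗ H], which is diagonal. *)
transitivity (cocycle_action (tens_action phiH phiH) (tens_action (mu H) (mu H))
   ∘ (idm A ⊗₁ (delta H ∘ pi))).
2:{ now rewrite <- cocycle_action_precomp, tensM_compr, comp_assoc. }
rewrite cocycle_action_tens, (coalgmor_comul coalg_pi).
unfold tens_action; rnest.
rewrite (algmor_mul (hopf_delta_mor A)); unfold tens_mu; rnest.
rewrite tensM_comp_eqr, pi_cocycle_action, tensM_comp; rnest.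
rewrite (comp_eqr (eq_sym (exch_nat _ _ _ _))). now fuse.
Qed.

(** The same cancellation, for [H] acting trivially on the unit object; both
    sides give [ε_H (π (a b))]. *)
Lemma counit_module_mor : is_module_mor phiH (triv_action A) (eps H).
Proof.
pose proof (counit_mu H) as eH; pose proof (counit_mu A) as eA.
unfold is_module_mor in *.
apply (cocycle_action_cancel (triv_module H)).
apply pi_epi.
transitivity (eps H ∘ pi ∘ mu A).
{ rnest. rewrite pi_cocycle_action. unfold cocycle_action; rnest.
  rewrite (comp_assoc (eps H) (mu H)), eH. now fuse. }
rewrite <- cocycle_action_precomp, (cocycle_action_triv).
rnest. rewrite <- tensM_compr, (comp_assoc (eps H)), (coalgmor_counit coalg_pi).
exact eA.
Qed.

End Cocycle.

End Actions.

(** * The category of modules over a cocycle *)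

Section CocycleModules.
Context {C : Category} {T : Monoidal C} {B : Braiding T} (symB : is_symmetric B).

Lemma is_iso_tens (a a' b b' : C) (f : Hom a a') (g : Hom b b') :
  is_iso f -> is_iso g -> is_iso (f ⊗₁ g).
Proof.
intros [f' [ff' f'f]] [g' [gg' g'g]]; exists (f' ⊗₁ g').
now rewrite <- !tensM_comp, ff', f'f, gg', g'g, !tensM_id.
Qed.

(** [exch] is composed of associators and a braiding, all of them linear. *)
Lemma exch_module_mor (D : HopfAlgebra B) (cocomm : is_cocommutative D) (M N P Q : C)
    (phiM : Hom (D ⊗ M) M) (phiN : Hom (D ⊗ N) N)
    (phiP : Hom (D ⊗ P) P) (phiQ : Hom (D ⊗ Q) Q) :
  is_module_mor (tens_action (tens_action phiM phiN) (tens_action phiP phiQ))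
    (tens_action (tens_action phiM phiP) (tens_action phiN phiQ)) (exch M N P Q).
Proof.
pose proof (assoc_module_mor symB (D := D)) as am.
pose proof (fun M P Q phiM phiP phiQ => module_mor_inv (am M P Q phiM phiP phiQ)) as amV.
unfold exch.
apply is_module_mor_comp with (2 := am _ _ _ phiM phiN (tens_action phiP phiQ)).
apply is_module_mor_comp with (1 := amV _ _ _ phiM phiP (tens_action phiN phiQ)).
apply tens_module_mor; [apply is_module_mor_id|].
apply is_module_mor_comp with (2 := amV _ _ _ phiN phiP phiQ).
apply is_module_mor_comp with (1 := am _ _ _ phiP phiN phiQ).
apply tens_module_mor; [|apply is_module_mor_id].
now apply braid_module_mor.
Qed.

Context (A H : HopfAlgebra B).
Context (cocommA : is_cocommutative A) (cocommH : is_cocommutative H).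
Context (phiH : Hom (A ⊗ H) H) (pi : Hom A H).
Context (cocycle : is_invertible_cocycle phiH pi).

(** The two equations of a module over the cocycle, read as the linearity over
    [A] of the action of [H] and of [γ]. *)
Lemma cocycle_module_intro (X : cocycle_module_data A H) :
  is_module (cm_phiM X) -> is_module (cm_varphiM X) ->
  is_module_mor (tens_action phiH (cm_phiM X)) (cm_phiM X) (cm_varphiM X) ->
  is_module (cm_phiN X) -> is_iso (cm_gamma X) ->
  is_module_mor (cm_phiN X)
    (cocycle_action pi (cm_phiM X) (cm_varphiM X)) (cm_gamma X) ->
  is_cocycle_module phiH pi X.
Proof.
intros m1 m2 c m3 i g; split; try assumption.
- rewrite <- c. unfold tens_action. now rewrite !comp_assoc.
- rewrite g. unfold cocycle_action. rewrite <- !comp_assoc, <- tensM_comp.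
  now rewrite comp_idl, comp_idr.
Qed.

Lemma cocycle_module_compat (X : cocycle_module phiH pi) :
  is_module_mor (tens_action phiH (cm_phiM X)) (cm_phiM X) (cm_varphiM X).
Proof.
unfold is_module_mor, tens_action. rewrite (cm_compat (cm_prop X)).
now rewrite !comp_assoc.
Qed.

Lemma cocycle_module_gamma (X : cocycle_module phiH pi) :
  is_module_mor (cm_phiN X)
    (cocycle_action pi (cm_phiM X) (cm_varphiM X)) (cm_gamma X).
Proof.
unfold is_module_mor, cocycle_action. rewrite (cm_gamma_eq (cm_prop X)).
rewrite <- !comp_assoc, <- tensM_comp. now rewrite comp_idl, comp_idr.
Qed.

Lemma triv_is_cocycle_module : is_cocycle_module phiH pi (triv_cocycle_module A H).
Proof.
apply cocycle_module_intro; simpl; try apply triv_module.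
- exact (is_module_mor_comp
    (counit_module_mor (cocycle_coalg cocycle) cocycle)
    (runit_module_mor symB cocommA phiH)).
- exists (idm munit); now rewrite comp_idl.
- rewrite (cocycle_action_triv (cocycle_coalg cocycle)).
  apply is_module_mor_id.
Qed.

Lemma tens_is_cocycle_module (X Y : cocycle_module phiH pi) :
  is_cocycle_module phiH pi (tens_cocycle_module X Y).
Proof.
destruct (cm_prop X), (cm_prop Y).
apply cocycle_module_intro; simpl.
- now apply tens_action_module.
- now apply tens_action_module.
- (* The fourth occurrence is the map [H ⊗ (M ⊗ P) → M ⊗ P] itself. *)
  unfold tens_action at 4; rewrite <- comp_assoc.
  apply is_module_mor_comp with (tens_action (tens_action phiH (cm_phiM X)) (tens_action phiH (cm_phiM Y))).
  + apply tens_module_mor; apply cocycle_module_compat.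
  + apply is_module_mor_comp with (1 := exch_module_mor cocommA _ _ _ _).
    apply tens_module_mor; [|apply is_module_mor_id].
    exact (delta_module_mor symB cocommA (cocycle_coalg cocycle) cocycle).
- now apply tens_action_module.
- now apply is_iso_tens.
- rewrite (cocycle_action_tens cocommA (cocycle_coalg cocycle)).
  apply tens_module_mor; apply cocycle_module_gamma.
Qed.

Definition munit_cm : CocycleMod phiH pi :=
  {| cm_data := triv_cocycle_module A H; cm_prop := triv_is_cocycle_module |}.

Definition tens_cm (X Y : CocycleMod phiH pi) : CocycleMod phiH pi :=
  {| cm_data := tens_cocycle_module X Y; cm_prop := tens_is_cocycle_module X Y |}.

Definition tensM_cm (X X' Y Y' : CocycleMod phiH pi) (f : Hom X X') (g : Hom Y Y') :
  Hom (tens_cm X Y) (tens_cm X' Y').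
Proof.
refine (@CocycleModuleMor _ _ _ _ _ (tens_cm X Y) (tens_cm X' Y')
  (cmm_h f ⊗₁ cmm_h g) (cmm_l f ⊗₁ cmm_l g) _ _ _ _).
- exact (tens_module_mor (cmm_h_phi f) (cmm_h_phi g)).
- exact (tens_module_mor (cmm_h_varphi f) (cmm_h_varphi g)).
- exact (tens_module_mor (cmm_l_phi f) (cmm_l_phi g)).
- abstract (simpl; now rewrite <- !tensM_comp, !cmm_gamma).
Defined.

(** A pair of isomorphisms of [C] that is a morphism is an isomorphism, because
    the inverse of a linear map is linear. *)
Definition iso_cm (X Y : CocycleMod phiH pi)
    (h : Iso (cm_M X) (cm_M Y)) (l : Iso (cm_N X) (cm_N Y))
    (hphi : is_module_mor (cm_phiM X) (cm_phiM Y) h)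
    (hvarphi : is_module_mor (cm_varphiM X) (cm_varphiM Y) h)
    (lphi : is_module_mor (cm_phiN X) (cm_phiN Y) l)
    (hl : h ∘ cm_gamma X = cm_gamma Y ∘ l) : Iso X Y.
Proof.
unshelve refine {|
  fwd := @CocycleModuleMor _ _ _ _ _ X Y h l hphi hvarphi lphi hl : @Hom (CocycleMod phiH pi) X Y;
  bwd := @CocycleModuleMor _ _ _ _ _ Y X (bwd h) (bwd l)
    (module_mor_inv hphi) (module_mor_inv hvarphi) (module_mor_inv lphi) _ |}.
- abstract (apply (iso_cancell (i := h)); rewrite !comp_assoc, fwd_bwd, comp_idl, hl;
    now rewrite <- comp_assoc, fwd_bwd, comp_idr).
- abstract (apply cocycle_module_mor_eq; apply bwd_fwd).
- abstract (apply cocycle_module_mor_eq; apply fwd_bwd).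
Defined.

Definition assoc_cm (X Y Z : CocycleMod phiH pi) :
  Iso (tens_cm (tens_cm X Y) Z) (tens_cm X (tens_cm Y Z)) :=
  @iso_cm (tens_cm (tens_cm X Y) Z) (tens_cm X (tens_cm Y Z))
    (assoc _ _ _) (assoc _ _ _)
    (assoc_module_mor symB _ _ _) (assoc_module_mor symB _ _ _)
    (assoc_module_mor symB _ _ _) (assoc_nat _ _ _).

Definition lunit_cm (X : CocycleMod phiH pi) : Iso (tens_cm munit_cm X) X :=
  @iso_cm (tens_cm munit_cm X) X (lunit _) (lunit _)
    (lunit_module_mor symB _) (lunit_module_mor symB _) (lunit_module_mor symB _)
    (lunit_nat _).

Definition runit_cm (X : CocycleMod phiH pi) : Iso (tens_cm X munit_cm) X :=
  @iso_cm (tens_cm X munit_cm) X (runit _) (runit _)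
    (runit_module_mor symB cocommA _) (runit_module_mor symB cocommH _)
    (runit_module_mor symB cocommA _) (runit_nat _).

Definition braid_cm (X Y : CocycleMod phiH pi) : Iso (tens_cm X Y) (tens_cm Y X) :=
  @iso_cm (tens_cm X Y) (tens_cm Y X) (braid _ _) (braid _ _)
    (braid_module_mor symB cocommA _ _) (braid_module_mor symB cocommH _ _)
    (braid_module_mor symB cocommA _ _) (braid_nat _ _).

Definition monoidal_cm : Monoidal (CocycleMod phiH pi).
Proof.
refine {| tens := tens_cm; tensM := tensM_cm; munit := munit_cm;
  assoc := assoc_cm; lunit := lunit_cm; runit := runit_cm |};
  intros; apply cocycle_module_mor_eq; simpl.
1, 2: apply tensM_id.
1, 2: apply tensM_comp.
1, 2: apply assoc_nat.
1, 2: apply lunit_nat.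
1, 2: apply runit_nat.
1, 2: apply triangle.
1, 2: apply pentagon.
Defined.

Definition braiding_cm : Braiding monoidal_cm.
Proof.
refine (@Build_Braiding _ monoidal_cm braid_cm _ _ _);
  intros; apply cocycle_module_mor_eq; simpl.
1, 2: apply braid_nat.
1, 2: apply hexagon1.
1, 2: apply hexagon2.
Defined.

Lemma symmetric_cm : is_symmetric braiding_cm.
Proof. intros X Y; apply cocycle_module_mor_eq; apply symB. Qed.

End CocycleModules.

Theorem theorem2p20
    (C : Category) (T : Monoidal C) (B : Braiding T)
    (strictC : is_strict T) (symC : is_symmetric B)
    (A H : HopfAlgebra B)
    (cocommA : is_cocommutative A) (cocommH : is_cocommutative H)
    (phiH : Hom (A ⊗ H) H) (modalgH : is_module_algebra (eta H) (mu H) phiH)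
    (pi : Hom A H) (cocycle_pi : is_invertible_cocycle phiH pi) :
  exists (TM : Monoidal (CocycleMod phiH pi)) (BM : Braiding TM),
    is_symmetric BM /\
    cm_data (@munit _ TM) = triv_cocycle_module A H /\
    (forall X Y : CocycleMod phiH pi,
       cm_data (@tens _ TM X Y) = tens_cocycle_module X Y).
Proof.
exists (monoidal_cm symC cocommA cocommH cocycle_pi).
exists (braiding_cm symC cocommA cocommH cocycle_pi).
split; [apply symmetric_cm | now split].
Qed.
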